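(* Let $G$ be a graph of order $n$ and size $m$. If $1\le p\le 2$, then $$\|G\|_{S_p}^p\le n^{1-p/2}(2m)^{p/2},$$ and if $p>2$, then $$\|G\|_{S_p}^p\ge n^{1-p/2}(2m)^{p/2}.$$
   Context: Graphs are finite, simple and undirected; the order of a graph is its number of vertices and its size is its number of edges. For a graph $G$ of order $n$ with adjacency matrix $A$, let $\sigma_1(G)\ge\cdots\ge\sigma_n(G)$ be the singular values of $A$ (the absolute values of its eigenvalues), and for real $p\ge1$ let $\|G\|_{S_p}=\left(\sigma_1^p(G)+\cdots+\sigma_n^p(G)\right)^{1/p}$ be the Schatten $p$-norm. *)

(* Defs.v *)
From mathcomp Require Import all_boot all_order all_algebra.
From mathcomp Require Import complex.
From mathcomp Require Import reals exp.

Set Implicit Arguments.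
Unset Strict Implicit.
Unset Printing Implicit Defensive.

Import Order.TTheory GRing.Theory Num.Theory.
Local Open Scope ring_scope.

Record sgraph := SGraph {
  vertex :> finType;
  adj : rel vertex;
  adj_sym : symmetric adj;
  adj_irrefl : irreflexive adj
}.

Definition graph_order (G : sgraph) : nat := #|G|.

Definition edges (G : sgraph) : {set {set G}} :=
  [set e : {set G} | [exists x : G, exists y : G, adj x y && (e == [set x; y])]].

Definition graph_size (G : sgraph) : nat := #|edges G|.

Definition adjmx (R : realType) (G : sgraph) : 'M[R]_(graph_order G) :=
  \matrix_(i < graph_order G, j < graph_order G) (adj (enum_val i) (enum_val j))%:R.

(* The complex eigenvalues, repeated according to algebraic multiplicity. The
   order of the sequence is unspecified: only the factorization of the
   characteristic polynomial recorded in [eigenvaluesP] is known about it. *)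
Definition eigenvalues (R : realType) (n : nat) (A : 'M[R]_n) : seq R[i] :=
  sval (closed_field_poly_normal (char_poly (map_mx (real_complex R) A))).

Lemma eigenvaluesP (R : realType) (n : nat) (A : 'M[R]_n) :
  char_poly (map_mx (real_complex R) A) =
  \prod_(z <- eigenvalues A) ('X - z%:P).
Proof.
rewrite /eigenvalues; case: closed_field_poly_normal => r /= def_r.
by rewrite {1}def_r (monicP (char_poly_monic _)) scale1r.
Qed.

Lemma size_eigenvalues (R : realType) (n : nat) (A : 'M[R]_n) :
  size (eigenvalues A) = n.
Proof.
have := size_char_poly (map_mx (real_complex R) A).
by rewrite eigenvaluesP size_prod_XsubC => -[].
Qed.

(* The singular values sigma_1 >= ... >= sigma_n of the adjacency matrix. It is
   symmetric, so these are the absolute values of its eigenvalues; for a matrix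
   that is not normal this would not be the right definition. [complex.Re] only
   casts the norm of R[i], which is real but R[i]-valued, back to R. *)
Definition singular_values (R : realType) (G : sgraph) : seq R :=
  sort >=%R [seq complex.Re `|z| | z <- eigenvalues (adjmx R G)].

(* Zero-based: [sigma R G i] is the (i+1)-st largest singular value. *)
Definition sigma (R : realType) (G : sgraph) (i : nat) : R :=
  (singular_values R G)`_i.

Definition schatten (R : realType) (p : R) (G : sgraph) : R :=
  (\sum_(i < graph_order G) sigma R G i `^ p) `^ p^-1.

(* Main.v *)
(** The squares of the singular values sum to the trace of A^2, that is, to the
    sum of the degrees, 2m. Both bounds are then the comparison between the
    mean of the n numbers sigma_i^2 and their power mean of exponent p/2, which
    follows from the tangent line to w^r at w = 1. *)
Require Import Defs.
From mathcomp Require Import all_boot all_order all_algebra.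
From mathcomp Require Import reals exp.
From mathcomp Require Import complex sesquilinear spectral ring lra.

Import Order.TTheory GRing.Theory Num.Theory.
Local Open Scope ring_scope.

Lemma powR_tangent_le (R : realType) (w r : R) :
  0 <= w -> 0 < r <= 1 -> w `^ r <= 1 + r * (w - 1).
Proof.
move=> w0 /andP[r0]; rewrite le_eqVlt => /orP[/eqP->|r1].
  by rewrite powRr1//; lra.
(* Young's inequality for w^r and 1, with exponents 1/r and 1/(1-r). *)
have := @conjugate_powR R (w `^ r) 1 r^-1 (1 - r)^-1 (powR_ge0 _ _) ler01.
rewrite !invr_gt0 subr_gt0 !invrK => /(_ r0 r1) H.
have := H ltac:(lra).
by rewrite mulr1 powR1 -powRrM divff ?gt_eqF// powRr1//; lra.
Qed.

(** Dividing each [x i] by the mean makes the mean 1. In the sum of the tangent bounds at 1, the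
    linear terms then cancel. *)
Lemma sum_powR_le (R : realType) (I : finType) (x : I -> R) (r : R) :
  (forall i, 0 <= x i) -> 0 < r <= 1 ->
  \sum_i x i `^ r <= #|I|%:R `^ (1 - r) * (\sum_i x i) `^ r.
Proof.
move=> x0 rI; have [r0 r1] := andP rI.
have S0 : 0 <= \sum_i x i by apply: sumr_ge0.
have [S_eq0|S_neq0] := eqVneq (\sum_i x i) 0.
  have xi0 i : x i = 0.
    by apply: (psumr_eq0P _ S_eq0).
  rewrite big1 ?mulr_ge0 ?powR_ge0// => i _.
  by rewrite xi0 powR0 ?gt_eqF.
have I0 : (#|I|%:R : R) != 0.
  rewrite pnatr_eq0; apply: contra S_neq0 => /eqP I0.
  by rewrite big1// => i; have := max_card (pred1 i); rewrite card1 I0.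
set S := \sum_i x i in S0 S_neq0 *; set N : R := #|I|%:R in I0 *.
have N0 : 0 < N by rewrite lt_neqAle eq_sym I0 ler0n.
have M0 : 0 < S / N by rewrite divr_gt0// lt_neqAle eq_sym S_neq0.
(* By homogeneity, the bound is [N] times the [r]-th power of the mean. *)
have -> : N `^ (1 - r) * S `^ r = (S / N) `^ r * N.
  rewrite powRM ?invr_ge0 ?(ltW N0)// -powR_inv1 ?(ltW N0)//.
  rewrite -powRrM mulN1r powRD ?I0 ?implybT// powRr1 ?(ltW N0)//.
  by rewrite mulrC mulrA [RHS]mulrAC.
have xM i : x i = S / N * (x i / (S / N)).
  by rewrite mulrCA divff ?mulr1 ?gt_eqF.
under eq_bigr => i _ do rewrite xM powRM ?(ltW M0) ?divr_ge0 ?(ltW M0)//.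
rewrite -mulr_sumr ler_wpM2l ?powR_ge0//.
apply: le_trans (_ : \sum_i (1 + r * (x i / (S / N) - 1)) <= _).
  by apply: ler_sum => i _; rewrite powR_tangent_le// divr_ge0 ?(ltW M0).
rewrite big_split/= -mulr_sumr big_split/= -mulr_suml !sumr_const cardT -cardE.
rewrite -/S -/N invf_div mulrC.
have -> : S * (N / S) = N by rewrite mulrCA divff ?mulr1.
by rewrite mulNrn subrr mul0r addr0.
Qed.

Lemma sum_powR_ge (R : realType) (I : finType) (x : I -> R) (r : R) :
  (forall i, 0 <= x i) -> 1 < r ->
  #|I|%:R `^ (1 - r) * (\sum_i x i) `^ r <= \sum_i x i `^ r.
Proof.
move=> x0 r1; have r0 : 0 < r by apply: lt_trans r1.
have [I0|I0] := eqVneq (#|I|%:R : R) 0.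
  by rewrite I0 powR0 ?mul0r ?sumr_ge0//; [move=> i _; exact: powR_ge0 | lra].
have rV : 0 < r^-1 <= 1 by rewrite invr_gt0 r0 invf_le1// ltW.
have := @sum_powR_le R I (fun i => x i `^ r) r^-1 (fun=> powR_ge0 _ _) rV.
under eq_bigr => i _ do rewrite -powRrM divff ?gt_eqF// powRr1//.
move=> /(ge0_ler_powR (ltW r0)).
rewrite !nnegrE sumr_ge0// mulr_ge0 ?powR_ge0// => /(_ isT isT).
rewrite powRM ?powR_ge0// -!powRrM mulVf ?gt_eqF// mulrBl mul1r mulVf ?gt_eqF//.
rewrite powRr1 ?sumr_ge0// => [H|i _]; last exact: powR_ge0.
apply: le_trans (ler_wpM2l (powR_ge0 _ _) H) _.
rewrite mulrA -powRD ?I0 ?implybT//.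
by rewrite (_ : 1 - r + (r - 1) = 0) ?powRr0 ?mul1r//; ring.
Qed.

Lemma char_poly_conj (F : fieldType) (n : nat) (P A : 'M[F]_n) :
  P \in unitmx -> char_poly (invmx P *m A *m P) = char_poly A.
Proof.
move=> Pu; rewrite /char_poly /char_poly_mx !map_mxM map_invmx.
set Q := map_mx polyC P; have Qu : Q \in unitmx by rewrite map_unitmx.
(* A scalar matrix is its own conjugate, so the whole characteristic matrix is conjugated by [Q]. *)
have XE : ('X%:M : 'M_n) = invmx Q *m 'X%:M *m Q by rewrite scalar_mxC mulmxKV.
rewrite {1}XE -mulmxBl -mulmxBr !det_mulmx mulrAC -det_mulmx mulVmx//.
by rewrite det1 mul1r.
Qed.

(** Over [R[i]] the matrix is Hermitian, hence unitarily diagonalizable with a real diagonal [D].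
    Both sides equal the trace of the square of [diag_mx D]. *)
Lemma sum_sqr_eigenvalues (R : realType) (n : nat) (A : 'M[R]_n) :
  A^T = A -> \sum_(z <- eigenvalues A) complex.Re `|z| ^+ 2 = \tr (A *m A).
Proof.
move=> Asym; set B := map_mx (real_complex R) A.
have Bherm : B \is hermsymmx.
  apply: realsym_hermsym.
    by apply/is_hermitianmxP; rewrite expr0 scale1r map_mx_id// /B map_trmx Asym.
  by apply/mxOverP => i j; rewrite mxE complex_real.
have /orthomx_spectralP B_eq := hermitian_normalmx Bherm.
have Dreal := hermitian_spectral_diag_real Bherm.
set P := spectralmx B in B_eq; set D := spectral_diag B in B_eq Dreal.
have Pu : P \in unitmx := spectral_unit B.
(* Two factorizations of the characteristic polynomial into monic linear factors agree up to
   order. *)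
have eigD : perm_eq (eigenvalues A) [seq D 0 i | i <- enum 'I_n].
  apply: prod_XsubC_eq; rewrite -eigenvaluesP -/B B_eq char_poly_conj//.
  rewrite char_poly_trig ?diag_mx_is_trig// big_map enumT.
  by apply: eq_bigr => i _; rewrite mxE eqxx.
apply: (@complexI R); rewrite (perm_big _ eigD) big_map enumT rmorph_sum.
rewrite -[RHS]trace_map_mx map_mxM -/B B_eq.
rewrite !mulmxA mulmxK// -!mulmxA mxtrace_mulC -!mulmxA mulmxV// mulmx1.
rewrite mulmx_diag mxtrace_diag; apply: eq_bigr => i _; rewrite mxE.
rewrite rmorphXn -[LHS]/(`|D 0 i| ^+ 2) real_normK ?expr2//.
exact: (mxOverP Dreal).
Qed.

(** Incident pairs of a vertex and an edge are counted in two ways. *)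
Lemma handshake (G : sgraph) :
  (\sum_(x : G) #|[pred y | adj x y]| = 2 * graph_size G)%N.
Proof.
have deg (x : G) : #|[pred y | adj x y]| = (\sum_(e in edges G) (x \in e))%N.
  (* Sending a neighbour [y] to the edge [[set x; y]] is a bijection onto the edges through [x];
     injectivity uses the absence of loops. *)
  rewrite -(@card_in_imset _ _ (fun y => [set x; y])); last first.
    move=> y z; rewrite !inE => xy xz /setP/(_ y).
    rewrite !inE eqxx orbT => /esym/orP[]/eqP//.
    by move=> yx; rewrite yx adj_irrefl in xy.
  rewrite -big_mkcondr sum1_card; apply: eq_card => e.
  apply/imsetP/andP => [[y]|[]].
    rewrite inE => xy ->; split; last by rewrite !inE eqxx.
    rewrite inE; apply/existsP; exists x; apply/existsP; exists y.
    by rewrite xy eqxx.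
  rewrite inE => /existsP[a /existsP[b /andP[ab /eqP->]]].
  rewrite !inE => /orP[]/eqP->; first by exists b.
  by exists a; rewrite ?inE 1?adj_sym// setUC.
under eq_bigr do rewrite deg.
rewrite exchange_big/= mulnC /graph_size -sum_nat_const; apply: eq_bigr => e.
rewrite inE => /existsP[a /existsP[b /andP[ab /eqP->]]].
rewrite -big_mkcond sum1_card cards2.
by case: eqP ab => // ->; rewrite adj_irrefl.
Qed.

(** By symmetry and since entries are 0 or 1, a diagonal entry of the square is the degree of its
    vertex. *)
Lemma trace_sqr_adjmx (R : realType) (G : sgraph) :
  \tr (adjmx R G *m adjmx R G) = 2 * (graph_size G)%:R.
Proof.
rewrite -natrM -handshake natr_sum /mxtrace.
rewrite [RHS](reindex (@enum_val G predT)) /=; last first.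
  by apply: onW_bij; apply: enum_val_bij.
apply: eq_bigr => i _; rewrite mxE -sum1_card natr_sum.
rewrite [RHS]big_mkcond [RHS](reindex (@enum_val G predT)) /=; last first.
  by apply: onW_bij; apply: enum_val_bij.
apply: eq_bigr => j _; rewrite !mxE inE (adj_sym (enum_val j)).
by case: adj; rewrite ?mulr1 ?mulr0.
Qed.

Lemma adjmx_tr (R : realType) (G : sgraph) : (adjmx R G)^T = adjmx R G.
Proof. by apply/matrixP => i j; rewrite !mxE adj_sym. Qed.

Lemma size_singular_values (R : realType) (G : sgraph) :
  size (singular_values R G) = graph_order G.
Proof. by rewrite size_sort size_map size_eigenvalues. Qed.

Lemma sigma_ge0 (R : realType) (G : sgraph) (i : nat) : 0 <= sigma R G i.
Proof.
have [iG|iG] := ltnP i (graph_order G); last first.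
  by rewrite /sigma nth_default// size_singular_values.
have : sigma R G i \in singular_values R G.
  by rewrite mem_nth// size_singular_values.
rewrite mem_sort => /mapP[z _ ->].
by rewrite normc_def sqrtr_ge0.
Qed.

Lemma sum_sqr_sigma (R : realType) (G : sgraph) :
  \sum_(i < graph_order G) sigma R G i ^+ 2 = 2 * (graph_size G)%:R.
Proof.
rewrite -trace_sqr_adjmx -sum_sqr_eigenvalues ?adjmx_tr//.
rewrite -(big_map (fun z : R[i] => complex.Re `|z|) predT (fun t => t ^+ 2)).
rewrite -(perm_big _ (permEl (perm_sort >=%R _))) -/(singular_values R G).
by rewrite (big_nth 0) size_singular_values big_mkord.
Qed.

Theorem proposition6 (R : realType) (G : sgraph) (n m : nat)
    (hn : graph_order G = n) (hm : graph_size G = m) (p : R) :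
  (1 <= p <= 2 ->
     schatten p G `^ p <= n%:R `^ (1 - p / 2) * (2 * m%:R) `^ (p / 2)) /\
  (2 < p ->
     schatten p G `^ p >= n%:R `^ (1 - p / 2) * (2 * m%:R) `^ (p / 2)).
Proof.
rewrite -hm -sum_sqr_sigma -hn.
(* The outer exponents [p^-1] and [p] cancel, and passing to squares gives the form of the power
   mean bounds with [r = p / 2]. *)
have schattenX : 0 < p -> schatten p G `^ p =
    \sum_(i < graph_order G) (sigma R G i ^+ 2) `^ (p / 2).
  move=> p0; rewrite -powRrM mulVf ?gt_eqF// powRr1; last first.
    by apply: sumr_ge0 => i _; apply: powR_ge0.
  apply: eq_bigr => i _.
  by rewrite -powR_mulrn ?sigma_ge0// -powRrM mulrC divfK ?pnatr_eq0.
have sqr_sigma_ge0 (i : 'I_(graph_order G)) : 0 <= sigma R G i ^+ 2.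
  exact: sqr_ge0.
split=> [/andP[p1 p2]|p2]; rewrite schattenX; try lra.
  by have := sum_powR_le _ _ _ (p / 2) sqr_sigma_ge0; rewrite card_ord; apply; lra.
by have := sum_powR_ge _ _ _ (p / 2) sqr_sigma_ge0; rewrite card_ord; apply; lra.
Qed.
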